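(* Let $c>0$ and let $k>0$. There exists a smooth solitary wave of the modified Camassa-Holm equation with speed $c$ and profile $\phi\in C^\infty(\mathbb R)$ satisfying $\phi(\xi)\to k$ as $|\xi|\to\infty$ if and only if $k\in\left(\frac{\sqrt c}{3},\frac{\sqrt{3c}}{3}\right)$. Moreover, in that case, for all $\xi\in\mathbb R$, $$k<\phi(\xi)\le \sup_{\xi\in\mathbb R}\phi=\sqrt{2(c-k^2)}-k<\sqrt c,\qquad \mu(\xi)=\phi(\xi)-\phi_{\xi\xi}(\xi)>0 .$$ With the added condition $\phi'(0)=0$, the solution $\phi$ is unique and is an even function of $\xi$.
   Context: The modified Camassa-Holm equation is $m_t+((u^2-u_x^2)m)_x=0$, $m=u-u_{xx}$. Travelling waves are solutions $u(t,x)=\phi(\xi)$, $\xi=x-ct$; after one integration the profile satisfies $$(\phi-\phi_{\xi\xi})(\phi_\xi^2-\phi^2+c)=a$$ for an integration constant $a\in\mathbb R$. A smooth solitary wave with background $k$ is a nonconstant $C^\infty(\mathbb R)$ solution $\phi$ of this equation with $\phi(\xi)\to k$ as $|\xi|\to\infty$, i.e. whose orbit $(\phi,\phi_\xi)$ is homoclinic to the equilibrium $(k,0)$ (so that $a=k(c-k^2)$). *)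

(* Defs.v *)
From Stdlib Require Import Reals.
From Coquelicot Require Import Coquelicot.
Open Scope R_scope.

Definition smooth (f : R -> R) : Prop :=
  forall (n : nat) (x : R), ex_derive_n f n x.

(** [mu phi] is the profile of the momentum density [m = u - u_xx]. *)
Definition mu (phi : R -> R) (xi : R) : R := phi xi - Derive_n phi 2 xi.

(** Integrated travelling-wave equation of
    [m_t + ((u^2 - u_x^2) m)_x = 0], [u(t,x) = phi(x - c t)]. *)
Definition profile_eq (c a : R) (phi : R -> R) : Prop :=
  forall xi : R, mu phi xi * ((Derive phi xi) ^ 2 - (phi xi) ^ 2 + c) = a.

(** The integration constant is left free: for a nonconstant smooth solution,
    [phi -> k] at both ends already forces [Derive phi -> 0] (so the orbit is
    homoclinic to [(k, 0)]) and [a = k * (c - k ^ 2)]. *)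
Definition solitary_wave (c k : R) (phi : R -> R) : Prop :=
  smooth phi /\
  (exists x y : R, phi x <> phi y) /\
  (exists a : R, profile_eq c a phi) /\
  is_lim phi p_infty k /\
  is_lim phi m_infty k.

Definition image (phi : R -> R) : R -> Prop :=
  fun y => exists xi : R, y = phi xi.

(* Main.v *)
Require Import Defs.
From Stdlib Require Import Reals Lra Psatz FunctionalExtensionality.
From Coquelicot Require Import Coquelicot.
Open Scope R_scope.

(** Write [w = phi'^2 - phi^2 + c] for the flux and [mu = phi - phi'']. Since
    [w' = - 2 phi' mu] and [mu w = a], the quantity [w^2 + 4 a phi] is conserved,
    so [w] and hence [phi'^2] are functions of [phi]. Both therefore converge at
    infinity, which forces [phi' -> 0] and then [a = k (c - k^2)]
    ([wave_invariants]). With [v = w / (c - k^2)], which is positive and tends to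
    [1] at both ends,
    [[
      phi = k + (c - k^2) (1 - v^2) / (4 k),      mu = k / v,
      16 k^2 phi'^2 = (c - k^2) (1 - v)^2 ((c - k^2) (1 + v)^2 - 8 k^2)
    ]]
    ([rel_flux_relations]). At an extremum different from [k] the last factor
    vanishes; this needs [c > k^2], and the positivity of [phi'^2] between the
    extremum and infinity excludes troughs. What remains is a crest with
    [1 + v = B], [B^2 = 8 k^2 / (c - k^2)] and [0 < v < 1], that is [1 < B < 2],
    which is the range of [k] ([wave_crest], [wave_range]) and gives the height
    of the wave ([wave_height]). A Gronwall estimate at [v = 1] makes [k < phi]
    strict ([wave_above_background]).

    For existence and uniqueness the first-order equation is useless at the
    crest, where its square root changes sign. The signed root
    [u = 2 v v' / (1 - v)] lies on the hyperbola [u^2 + B^2 = (1 + v)^2] and obeys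
    the regular equation [u' = (1 - v^2) / (2 v) > 0], with [v] the function
    [sqrt (u^2 + B^2) - 1] of [u]. In a logarithmic coordinate [t] on the interval
    [u^2 < 4 - B^2] it becomes [t' = h t] with [h] continuous and bounded between
    positive constants, which is solved globally and uniquely by separating
    variables ([autonomous_exists], [autonomous_unique]). The condition
    [phi'(0) = 0] means [u 0 = 0], so it selects one orbit; that orbit is even
    because reflection preserves solitary waves. Smoothness is automatic: the
    derivatives of [u], [v] and [1 / v] are polynomials in these three functions. *)

(** * Real functions with a prescribed derivative *)

Lemma derivable_continuity_pt (f df : R -> R) (x : R) :
  is_derive f x (df x) -> continuity_pt f x.
Proof.
  intros H. apply continuity_pt_filterlim.
  apply (ex_derive_continuous f x). now exists (df x).
Qed.

Lemma mean_value (f df : R -> R) (a b : R) :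
  (forall x, is_derive f x (df x)) -> a < b ->
  exists x, a <= x <= b /\ f b - f a = df x * (b - a).
Proof.
  intros H hab. destruct (MVT_gen f a b df) as [x [hx e]].
  - intros; apply H.
  - intros; apply (derivable_continuity_pt f df); apply H.
  - rewrite Rmin_left, Rmax_right in hx by lra. now exists x.
Qed.

Lemma derive_zero_const (f df : R -> R) :
  (forall x, is_derive f x (df x)) -> (forall x, df x = 0) ->
  forall x y, f x = f y.
Proof.
  intros H h0.
  assert (lt : forall x y, x < y -> f x = f y).
  { intros x y hxy. destruct (mean_value f df x y H hxy) as [z [_ e]].
    rewrite h0 in e. lra. }
  intros x y. destruct (Rtotal_order x y) as [h | [-> | h]]; auto.
  symmetry; auto.
Qed.

Lemma lim_p_infty_eps (f : R -> R) (l eps : R) :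
  is_lim f p_infty l -> 0 < eps ->
  exists M, forall x, M < x -> Rabs (f x - l) < eps.
Proof.
  intros H he. apply is_lim_spec in H. exact (H (mkposreal eps he)).
Qed.

Lemma lim_m_infty_eps (f : R -> R) (l eps : R) :
  is_lim f m_infty l -> 0 < eps ->
  exists M, forall x, x < M -> Rabs (f x - l) < eps.
Proof.
  intros H he. apply is_lim_spec in H. exact (H (mkposreal eps he)).
Qed.

(** Only a sequence of points is obtained: the derivative of a convergent
    function need not converge. It identifies the limit of any continuous
    expression in the derivative that is known to converge. *)
Lemma lim_derive_small (f df : R -> R) (l eps M : R) :
  is_lim f p_infty l -> (forall x, is_derive f x (df x)) -> 0 < eps ->
  exists x, M < x /\ Rabs (df x) < eps.
Proof.
  intros hl H he.
  destruct (lim_p_infty_eps f l (eps / 2) hl) as [N hN]; [lra|].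
  pose (a := Rmax M N + 1).
  pose proof (Rmax_l M N). pose proof (Rmax_r M N).
  destruct (mean_value f df a (a + 1) H) as [x [hx e]]; [lra|].
  exists x. split; [unfold a in hx; lra|].
  assert (h1 := hN a ltac:(unfold a; lra)).
  assert (h2 := hN (a + 1) ltac:(unfold a; lra)).
  replace (df x) with (f (a + 1) - f a) by (rewrite e; ring).
  apply Rabs_def2 in h1. apply Rabs_def2 in h2. apply Rabs_def1; lra.
Qed.

Lemma peak_exists (f df : R -> R) (l x1 : R) :
  (forall x, is_derive f x (df x)) ->
  is_lim f p_infty l -> is_lim f m_infty l -> l < f x1 ->
  exists x0, df x0 = 0 /\ forall x, f x <= f x0.
Proof.
  intros H hp hm h1.
  destruct (lim_p_infty_eps f l (f x1 - l) hp) as [N hN]; [lra|].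
  destruct (lim_m_infty_eps f l (f x1 - l) hm) as [M hM]; [lra|].
  pose (a := Rmin x1 M - 1). pose (b := Rmax x1 N + 1).
  pose proof (Rmin_l x1 M). pose proof (Rmin_r x1 M).
  pose proof (Rmax_l x1 N). pose proof (Rmax_r x1 N).
  destruct (continuity_ab_maj f a b) as [x0 [hx0 _]].
  - unfold a, b; lra.
  - intros; apply (derivable_continuity_pt f df); apply H.
  - assert (hmax : forall x, f x <= f x0).
    { assert (h01 : f x1 <= f x0) by (apply hx0; unfold a, b; lra).
      intros x. destruct (Rlt_le_dec x a) as [h | h].
      - assert (e := hM x ltac:(unfold a in h; lra)).
        apply Rabs_def2 in e. lra.
      - destruct (Rlt_le_dec b x) as [h' | h'].
        + assert (e := hN x ltac:(unfold b in h'; lra)).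
          apply Rabs_def2 in e. lra.
        + apply hx0; lra. }
    exists x0. split; [|exact hmax].
    assert (hd : derivable_pt_lim f x0 (df x0)) by (apply is_derive_Reals; auto).
    pose (pr := exist (fun l => derivable_pt_abs f x0 l) (df x0) hd
                : derivable_pt f x0).
    change (df x0) with (derive_pt f x0 pr).
    apply (deriv_maximum f (x0 - 1) (x0 + 1)); try lra. intros; apply hmax.
Qed.

(** Gronwall's inequality in its qualitative form: [z exp (- C x)] decreases
    and [z exp (C x)] increases, so a zero spreads in both directions. *)
Lemma zero_propagates (z dz : R -> R) (C x0 : R) :
  (forall x, is_derive z x (dz x)) -> (forall x, 0 <= z x) ->
  (forall x, Rabs (dz x) <= C * z x) -> z x0 = 0 -> forall x, z x = 0.
Proof.
  intros H hz hC h0 x.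
  assert (D : forall s y, is_derive (fun y => z y * exp (s * y)) y
                            ((dz y + s * z y) * exp (s * y))).
  { intros s y.
    assert (e : Derive (fun x => z x) y = dz y) by (apply is_derive_unique, H).
    auto_derive.
    - exists (dz y). apply H.
    - rewrite e. ring. }
  assert (pos := fun s y => exp_pos (s * y)).
  destruct (Rtotal_order x x0) as [h | [-> | h]]; auto.
  - destruct (mean_value _ _ x x0 (D C) h) as [y [_ e]].
    assert (hy := hC y). apply Rabs_le_between in hy.
    rewrite h0 in e.
    assert (0 <= (dz y + C * z y) * exp (C * y) * (x0 - x)).
    { apply Rmult_le_pos; [apply Rmult_le_pos|]; try lra.
      left; apply pos. }
    specialize (hz x). specialize (pos C x). nra.
  - destruct (mean_value _ _ x0 x (D (- C)) h) as [y [_ e]].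
    assert (hy := hC y). apply Rabs_le_between in hy.
    rewrite h0 in e.
    assert (0 <= - (dz y + - C * z y) * exp (- C * y) * (x - x0)).
    { apply Rmult_le_pos; [apply Rmult_le_pos|]; try lra.
      left; apply pos. }
    specialize (hz x). specialize (pos (- C) x). nra.
Qed.

(** * Smoothness of a differentially closed algebra *)

Inductive algebra_of (gen : (R -> R) -> Prop) : (R -> R) -> Prop :=
| alg_gen f : gen f -> algebra_of gen f
| alg_const r : algebra_of gen (fun _ => r)
| alg_plus f g : algebra_of gen f -> algebra_of gen g ->
    algebra_of gen (fun x => f x + g x)
| alg_mult f g : algebra_of gen f -> algebra_of gen g ->
    algebra_of gen (fun x => f x * g x).

(** If the derivatives of the generators are polynomials in the generators, the
    algebra is stable under differentiation, so its members can be
    differentiated indefinitely. *)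
Lemma algebra_of_smooth (gen : (R -> R) -> Prop) :
  (forall f, gen f ->
     exists g, algebra_of gen g /\ forall x, is_derive f x (g x)) ->
  forall f, algebra_of gen f -> smooth f.
Proof.
  intros hgen.
  assert (D : forall f, algebra_of gen f ->
     exists g, algebra_of gen g /\ forall x, is_derive f x (g x)).
  { intros f hf.
    induction hf as [f hf | r | f g Af [f' [A1 B1]] Ag [g' [A2 B2]]
                    | f g Af [f' [A1 B1]] Ag [g' [A2 B2]]].
    - auto.
    - exists (fun _ => 0). split; [apply alg_const|].
      intros x. apply (@is_derive_const R_AbsRing R_NormedModule).
    - exists (fun x => f' x + g' x). split; [now apply alg_plus|].
      intros x. now apply (@is_derive_plus R_AbsRing R_NormedModule).
    - exists (fun x => f' x * g x + f x * g' x).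
      split; [apply alg_plus; now apply alg_mult|].
      intros x. apply (is_derive_mult f g x); auto. exact Rmult_comm. }
  assert (N : forall n f, algebra_of gen f ->
     exists g, algebra_of gen g /\ forall x, Derive_n f n x = g x).
  { induction n as [|n IH]; intros f hf.
    - exists f. split; auto.
    - destruct (IH f hf) as [g [Ag eg]]. destruct (D g Ag) as [g' [A e]].
      exists g'. split; auto. intros x. simpl.
      rewrite (Derive_ext _ g) by auto. now apply is_derive_unique. }
  intros f hf n x. destruct n as [|n]; [exact I|]. simpl.
  destruct (N n f hf) as [g [Ag eg]]. destruct (D g Ag) as [g' [A e]].
  apply (ex_derive_ext g). { intros; symmetry; auto. } now exists (g' x).
Qed.

(** * Scalar autonomous equations with a bounded positive right-hand side *)

Definition travel_time (h : R -> R) (t : R) : R := RInt (fun s => / h s) 0 t.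

Lemma travel_time_derive (h : R -> R) (t : R) :
  (forall s, continuous h s) -> (forall s, 0 < h s) ->
  is_derive (travel_time h) t (/ h t).
Proof.
  intros hc hp.
  assert (C : forall s, continuous (fun s => / h s) s).
  { intros s. apply (continuous_comp h Rinv); [apply hc|].
    apply continuous_Rinv. specialize (hp s); lra. }
  apply (is_derive_RInt (fun s => / h s) (travel_time h) 0); [|apply C].
  apply filter_forall. intros y. apply (@RInt_correct R_CompleteNormedModule).
  apply (@ex_RInt_continuous R_CompleteNormedModule). intros; apply C.
Qed.

(** Separation of variables: along a solution the travel time from [0] is the
    elapsed time, and the travel time is strictly increasing. *)
Lemma autonomous_unique (h y1 y2 : R -> R) :
  (forall s, continuous h s) -> (forall s, 0 < h s) ->
  (forall x, is_derive y1 x (h (y1 x))) ->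
  (forall x, is_derive y2 x (h (y2 x))) ->
  y1 0 = y2 0 -> forall x, y1 x = y2 x.
Proof.
  intros hc hp d1 d2 h0 x.
  assert (D := fun t => travel_time_derive h t hc hp).
  assert (T : forall y, (forall x, is_derive y x (h (y x))) ->
    forall x, travel_time h (y x) - x = travel_time h (y 0) - 0).
  { intros y d x'.
    apply (derive_zero_const (fun x => travel_time h (y x) - x)
             (fun x => h (y x) * / h (y x) - 1)).
    - intros z. apply @is_derive_minus; [|apply @is_derive_id].
      apply (is_derive_comp (travel_time h) y z); auto.
    - intros z. specialize (hp (y z)). field. lra. }
  assert (e : travel_time h (y1 x) = travel_time h (y2 x)).
  { generalize (T y1 d1 x) (T y2 d2 x). rewrite h0. lra. }
  assert (inc : forall a b, a < b -> travel_time h a < travel_time h b).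
  { intros a b hab. destruct (mean_value _ _ a b D hab) as [z [_ E]].
    assert (0 < / h z * (b - a)); [|lra].
    apply Rmult_lt_0_compat; [apply Rinv_0_lt_compat; auto | lra]. }
  destruct (Rtotal_order (y1 x) (y2 x)) as [g | [g | g]]; auto;
    apply inc in g; lra.
Qed.

(** The upper bound on [h] prevents escape in finite time: the travel time grows
    at least linearly, so it is a bijection of the line, and its inverse is the
    solution. *)
Lemma autonomous_exists (h : R -> R) (M : R) :
  (forall s, continuous h s) -> (forall s, 0 < h s <= M) ->
  exists y : R -> R, y 0 = 0 /\ forall x, is_derive y x (h (y x)).
Proof.
  intros hc hM. set (G := travel_time h).
  assert (D : forall t, is_derive G t (/ h t))
    by (intros; apply travel_time_derive; auto; apply hM).
  assert (M0 : 0 < M) by (generalize (hM 0); lra).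
  assert (low : forall a b, a < b -> b - a <= M * (G b - G a)).
  { intros a b hab. destruct (mean_value _ _ a b D hab) as [z [_ E]].
    rewrite E. destruct (hM z) as [p q].
    assert (1 <= M * / h z).
    { rewrite <- (Rinv_r (h z)) by lra. apply Rmult_le_compat_r; auto.
      left; now apply Rinv_0_lt_compat. }
    nra. }
  assert (lowabs : forall a b, Rabs (b - a) <= M * Rabs (G b - G a)).
  { intros a b. destruct (Rtotal_order a b) as [l | [-> | l]].
    - specialize (low a b l). rewrite !Rabs_right; nra.
    - rewrite !Rminus_diag, Rabs_R0. lra.
    - specialize (low b a l). rewrite !Rabs_left; nra. }
  assert (G0 : G 0 = 0) by apply @RInt_point.
  assert (cG : continuity G)
    by (intros x; apply (derivable_continuity_pt G (fun t => / h t)); auto).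
  assert (surj : forall x, {t | G t = x}).
  { intros x. destruct (IVT_gen G (- M * Rabs x - 1) (M * Rabs x + 1) x cG)
      as [t [_ e]]; [|now exists t].
    pose proof (Rabs_pos x).
    pose proof (Rle_abs x). pose proof (Rle_abs (- x)). rewrite Rabs_Ropp in *.
    assert (l1 := low 0 (M * Rabs x + 1) ltac:(nra)).
    assert (l2 := low (- M * Rabs x - 1) 0 ltac:(nra)).
    rewrite G0 in *.
    split.
    - eapply Rle_trans; [apply Rmin_l|]. nra.
    - eapply Rle_trans; [|apply Rmax_r]. nra. }
  pose (y := fun x => proj1_sig (surj x)).
  assert (Gy : forall x, G (y x) = x) by (intros x; apply (proj2_sig (surj x))).
  exists y. split.
  { assert (l := lowabs 0 (y 0)). rewrite Gy, G0, Rminus_diag, Rabs_R0 in l.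
    assert (e : Rabs (y 0 - 0) = 0) by (generalize (Rabs_pos (y 0 - 0)); lra).
    apply Rabs_eq_0 in e. lra. }
  intros x. apply is_derive_Reals. intros eps he.
  assert (dG := D (y x)). apply is_derive_Reals in dG.
  destruct (hM (y x)) as [hpos _].
  destruct (dG (eps / (M * h (y x)))) as [delta hd].
  { apply Rdiv_lt_0_compat; nra. }
  assert (dpos : 0 < delta / M) by (apply Rdiv_lt_0_compat; [apply cond_pos | lra]).
  exists (mkposreal _ dpos). simpl. intros s hs hlt.
  pose (r := y (x + s) - y x).
  assert (er : G (y x + r) - G (y x) = s).
  { unfold r. replace (y x + (y (x + s) - y x)) with (y (x + s)) by ring.
    rewrite !Gy. ring. }
  assert (rs : Rabs r <= M * Rabs s).
  { rewrite <- er. replace r with (y x + r - y x) at 1 by ring. apply lowabs. }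
  assert (r0 : r <> 0).
  { intros e. rewrite e, Rplus_0_r in er. lra. }
  specialize (hd r r0).
  assert (rd : Rabs r < delta).
  { eapply Rle_lt_trans; [exact rs|].
    apply (Rmult_lt_compat_l M) in hlt; [|lra].
    replace (M * (delta / M)) with (pos delta) in hlt by (field; lra). lra. }
  specialize (hd rd). rewrite er in hd.
  (* with q = s / r, the error of r / s is h |q - 1 / h| |r / s| *)
  replace ((y (x + s) - y x) / s - h (y x))
    with (- (h (y x) * (r / s) * (s / r - / h (y x)))) by (unfold r in *; field; lra).
  rewrite Rabs_Ropp, !Rabs_mult, (Rabs_right (h (y x))) by lra.
  assert (q : Rabs (r / s) <= M).
  { unfold Rdiv. rewrite Rabs_mult, Rabs_inv.
    assert (0 < Rabs s) by now apply Rabs_pos_lt.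
    apply (Rmult_le_reg_r (Rabs s)); auto. rewrite Rmult_assoc, Rinv_l by lra.
    lra. }
  apply Rle_lt_trans with (h (y x) * M * Rabs (s / r - / h (y x))).
  { apply Rmult_le_compat_r; [apply Rabs_pos|].
    apply Rmult_le_compat_l; lra. }
  apply (Rmult_lt_compat_l (M * h (y x))) in hd; [|nra].
  replace (M * h (y x) * (eps / (M * h (y x)))) with eps in hd by (field; lra).
  lra.
Qed.

(** * First integrals of a solitary wave *)

Definition flux (c : R) (phi : R -> R) (x : R) : R :=
  (Derive phi x) ^ 2 - (phi x) ^ 2 + c.

Lemma smooth_derive (phi : R -> R) (x : R) :
  smooth phi -> is_derive phi x (Derive phi x).
Proof. intros H. apply Derive_correct. exact (H 1%nat x). Qed.

Lemma smooth_derive2 (phi : R -> R) (x : R) :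
  smooth phi -> is_derive (Derive phi) x (Derive_n phi 2 x).
Proof. intros H. apply (Derive_correct (Derive phi)). exact (H 2%nat x). Qed.

Lemma flux_derive (c : R) (phi : R -> R) (x : R) :
  smooth phi ->
  is_derive (flux c phi) x (- 2 * Derive phi x * mu phi x).
Proof.
  intros H. unfold flux.
  assert (h1 := smooth_derive phi x H). assert (h2 := smooth_derive2 phi x H).
  evar_last.
  - apply (is_derive_plus (fun x => Derive phi x ^ 2 - phi x ^ 2) (fun _ => c)).
    + apply (is_derive_minus (fun x => Derive phi x ^ 2) (fun x => phi x ^ 2)).
      * apply (is_derive_pow (Derive phi) 2 x _ h2).
      * apply (is_derive_pow phi 2 x _ h1).
    + apply (@is_derive_const R_AbsRing R_NormedModule).
  - unfold mu, minus, plus, opp, zero. simpl. ring.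
Qed.

Lemma flux_first_integral (c a : R) (phi : R -> R) :
  smooth phi -> profile_eq c a phi ->
  exists E, forall x, flux c phi x ^ 2 + 4 * a * phi x = E.
Proof.
  intros H P. exists (flux c phi 0 ^ 2 + 4 * a * phi 0). intros x.
  apply (derive_zero_const (fun x => flux c phi x ^ 2 + 4 * a * phi x)
    (fun x => 2 * (- 2 * Derive phi x * mu phi x) * flux c phi x
              + 4 * a * Derive phi x)).
  - intros y. evar_last.
    + apply (is_derive_plus (fun x => flux c phi x ^ 2) (fun x => 4 * a * phi x)).
      * apply (is_derive_pow (flux c phi) 2 y _ (flux_derive c phi y H)).
      * apply (is_derive_scal phi y (4 * a)). now apply smooth_derive.
    + unfold plus. simpl. ring.
  - intros y. assert (e := P y). fold (flux c phi y) in e. rewrite <- e. ring.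
Qed.

(** A zero of the flux forces [a = 0], in which case the flux is constant: in
    every case it keeps one sign and is therefore a continuous function of the
    profile alone. *)
Lemma flux_of_profile (c a : R) (phi : R -> R) :
  smooth phi -> profile_eq c a phi ->
  exists E s, s ^ 2 = 1 /\
    forall x, flux c phi x ^ 2 = E - 4 * a * phi x /\
              flux c phi x = s * sqrt (E - 4 * a * phi x).
Proof.
  intros H P. destruct (flux_first_integral c a phi H P) as [E hE].
  set (w := flux c phi) in *.
  assert (hE' : forall x, w x ^ 2 = E - 4 * a * phi x)
    by (intros x; rewrite <- (hE x); ring).
  assert (S : (forall x, w x = 0) \/ (forall x, w x <> 0)).
  { destruct (Req_dec a 0) as [a0 | a0].
    - destruct (Req_dec E 0) as [E0 | E0]; [left | right]; intros x;
        specialize (hE x); rewrite a0 in hE; [nra|].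
      intros e. rewrite e in hE. lra.
    - right. intros x e. apply a0. rewrite <- (P x). fold (flux c phi x). fold w.
      rewrite e. ring. }
  assert (cw : continuity w).
  { intros x. apply (derivable_continuity_pt w
      (fun x => - 2 * Derive phi x * mu phi x)). now apply flux_derive. }
  assert (one_sign : (forall x, 0 <= w x) \/ (forall x, w x <= 0)).
  { destruct S as [S | S]; [left; intros x; rewrite S; lra|].
    assert (same : forall x y, 0 < w x * w y).
    { assert (le : forall x y, x <= y -> 0 < w x * w y).
      { intros x y hxy. destruct (Rlt_le_dec 0 (w x * w y)) as [h | h]; auto.
        destruct (IVT_cor w x y cw hxy h) as [z [_ hz]]. now apply S in hz. }
      intros x y. destruct (Rle_lt_dec x y); auto.
      rewrite Rmult_comm. apply le. lra. }
    destruct (Rlt_le_dec 0 (w 0)) as [h | h]; [left | right]; intros x;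
      specialize (same 0 x); nra. }
  exists E. destruct one_sign as [h | h]; [exists 1 | exists (- 1)];
    (split; [ring|]); intros x; (split; [auto|]); rewrite <- hE'.
  - rewrite sqrt_pow2; auto. ring.
  - replace (w x ^ 2) with ((- w x) ^ 2) by ring.
    rewrite sqrt_pow2; [ring|]. specialize (h x); lra.
Qed.

Lemma lim_comp_continuous (f g : R -> R) (x : Rbar) (l : R) :
  is_lim f x l -> continuous g l -> is_lim (fun y => g (f y)) x (g l).
Proof. intros hf hg. exact (filterlim_comp _ _ _ f g _ _ _ hf hg). Qed.

(** The limit of [phi'^2] exists because it is a continuous function of [phi],
    and it vanishes because [phi'] is small somewhere near infinity. *)
Lemma wave_limits (c a E s k : R) (phi : R -> R) :
  smooth phi -> is_lim phi p_infty k ->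
  (forall x, flux c phi x = s * sqrt (E - 4 * a * phi x)) ->
  s * sqrt (E - 4 * a * k) = c - k ^ 2 /\
  is_lim (Derive phi) p_infty 0 /\ is_lim (flux c phi) p_infty (c - k ^ 2).
Proof.
  intros H hk hw.
  assert (D1 := fun x => smooth_derive phi x H).
  assert (Cs : continuous (fun y => s * sqrt (E - 4 * a * y)) k).
  { apply (continuous_mult (fun _ => s) (fun y => sqrt (E - 4 * a * y))).
    - apply continuous_const.
    - apply continuous_comp; [|apply continuous_sqrt].
      apply (ex_derive_continuous (fun y => E - 4 * a * y)). now auto_derive. }
  set (g := fun y => s * sqrt (E - 4 * a * y)) in *.
  assert (lw : is_lim (flux c phi) p_infty (g k)).
  { apply (is_lim_ext (fun x => g (phi x))); [intros; symmetry; apply hw|].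
    now apply lim_comp_continuous. }
  set (Q := g k + k ^ 2 - c).
  assert (lD : is_lim (fun x => Derive phi x ^ 2) p_infty Q).
  { apply (is_lim_ext (fun x => flux c phi x + (phi x ^ 2 - c))).
    { intros; unfold flux; ring. }
    replace Q with (g k + (k ^ 2 - c)) by (unfold Q; ring).
    apply (is_lim_plus' _ (fun x => phi x ^ 2 - c)); auto.
    apply (lim_comp_continuous phi (fun y => y ^ 2 - c)); auto.
    apply (ex_derive_continuous (fun y => y ^ 2 - c)). now auto_derive. }
  assert (Q0 : Q = 0).
  { destruct (Req_dec Q 0) as [e | ne]; auto. exfalso.
    assert (qp := Rabs_pos_lt Q ne).
    destruct (lim_p_infty_eps _ Q (Rabs Q / 2) lD) as [N hN]; [lra|].
    destruct (lim_derive_small phi (Derive phi) k (Rmin 1 (Rabs Q / 2)) N hk D1)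
      as [x [hx hd]].
    { apply Rmin_pos; lra. }
    specialize (hN x hx).
    pose proof (Rmin_l 1 (Rabs Q / 2)). pose proof (Rmin_r 1 (Rabs Q / 2)).
    pose proof (Rabs_pos (Derive phi x)).
    assert (Rabs (Derive phi x ^ 2) <= Rabs Q / 2)
      by (rewrite <- RPow_abs; nra).
    assert (t := Rabs_triang_inv Q (Derive phi x ^ 2)).
    rewrite Rabs_minus_sym in hN. lra. }
  assert (gk : g k = c - k ^ 2) by (unfold Q in Q0; lra).
  split; [exact gk|]. split; [|now rewrite <- gk].
  apply is_lim_spec. intros eps.
  destruct (lim_p_infty_eps _ Q (eps ^ 2) lD) as [N hN].
  { generalize (cond_pos eps). nra. }
  exists N. intros x hx. specialize (hN x hx).
  rewrite Q0 in hN. rewrite Rminus_0_r in *. rewrite <- RPow_abs in hN.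
  generalize (cond_pos eps) (Rabs_pos (Derive phi x)). nra.
Qed.

(** Along points where [phi''] is small the profile equation tends to
    [a = k (c - k^2)]. *)
Lemma wave_invariants (c k : R) (phi : R -> R) :
  solitary_wave c k phi ->
  profile_eq c (k * (c - k ^ 2)) phi /\
  forall x, flux c phi x ^ 2
              = (c - k ^ 2) ^ 2 - 4 * k * (c - k ^ 2) * (phi x - k) /\
            0 <= (c - k ^ 2) * flux c phi x.
Proof.
  intros [H [_ [[a P] [hk _]]]].
  destruct (flux_of_profile c a phi H P) as [E [s [hs hw]]].
  destruct (wave_limits c a E s k phi H hk (fun x => proj2 (hw x)))
    as [h0 [lD lw]].
  set (w0 := c - k ^ 2) in *.
  assert (a0 : a = k * w0).
  { destruct (Req_dec a (k * w0)) as [e | ne]; auto. exfalso.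
    assert (ne' : a - k * w0 <> 0) by lra.
    assert (pos := Rabs_pos_lt _ ne'). set (d := Rabs (a - k * w0)) in *.
    assert (lp : is_lim (fun x => phi x * flux c phi x) p_infty (k * w0))
      by (apply (is_lim_mult _ _ _ k w0); auto; exact I).
    destruct (lim_p_infty_eps _ _ (d / 2) lp) as [N1 hN1]; [lra|].
    destruct (lim_p_infty_eps _ _ 1 lw) as [N2 hN2]; [lra|].
    pose proof (Rabs_pos w0).
    destruct (lim_derive_small (Derive phi) (Derive_n phi 2) 0
      (d / (2 * (Rabs w0 + 1))) (Rmax N1 N2) lD) as [x [hx hd]].
    { intros; now apply smooth_derive2. }
    { apply Rdiv_lt_0_compat; lra. }
    pose proof (Rmax_l N1 N2). pose proof (Rmax_r N1 N2).
    specialize (hN1 x ltac:(lra)). specialize (hN2 x ltac:(lra)).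
    assert (f1 : Rabs (flux c phi x) < Rabs w0 + 1)
      by (generalize (Rabs_triang_inv (flux c phi x) w0); lra).
    assert (e : a = (phi x - Derive_n phi 2 x) * flux c phi x)
      by (symmetry; apply P).
    assert (small : Rabs (Derive_n phi 2 x * flux c phi x) <= d / 2).
    { rewrite Rabs_mult.
      replace (d / 2) with (d / (2 * (Rabs w0 + 1)) * (Rabs w0 + 1))
        by (field; lra).
      apply Rmult_le_compat; try apply Rabs_pos; lra. }
    assert (d <= Rabs (phi x * flux c phi x - k * w0)
                 + Rabs (Derive_n phi 2 x * flux c phi x)); [|lra].
    unfold d. rewrite e at 1.
    replace ((phi x - Derive_n phi 2 x) * flux c phi x - k * w0)
      with ((phi x * flux c phi x - k * w0)
            + - (Derive_n phi 2 x * flux c phi x)) by ring.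
    rewrite <- (Rabs_Ropp (Derive_n phi 2 x * flux c phi x)).
    apply Rabs_triang. }
  rewrite a0 in *. clear a0.
  split; [exact P|].
  assert (Epos : 0 <= E - 4 * (k * w0) * k).
  { destruct (Rle_lt_dec 0 (E - 4 * (k * w0) * k)) as [l | l]; auto. exfalso.
    rewrite sqrt_neg_0 in h0 by lra.
    assert (w00 : w0 = 0) by lra. rewrite w00 in *.
    destruct (hw 0) as [e _]. generalize (pow2_ge_0 (flux c phi 0)). lra. }
  assert (eE : w0 ^ 2 = E - 4 * (k * w0) * k)
    by (rewrite <- h0 at 1; rewrite Rpow_mult_distr, hs, pow2_sqrt by auto; ring).
  intros x. destruct (hw x) as [e1 e2]. split.
  - rewrite e1. lra.
  - rewrite <- h0 at 1. rewrite e2.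
    replace (s * sqrt (E - 4 * (k * w0) * k) * (s * sqrt (E - 4 * (k * w0) * phi x)))
      with (s ^ 2 * (sqrt (E - 4 * (k * w0) * k) * sqrt (E - 4 * (k * w0) * phi x)))
      by ring.
    rewrite hs, Rmult_1_l. apply Rmult_le_pos; apply sqrt_pos.
Qed.

(** * The range of admissible backgrounds *)

(** The first integral makes the profile a quadratic polynomial in this
    quantity, whereas the flux is a square root of the profile. *)
Definition rel_flux (c k : R) (phi : R -> R) (x : R) : R :=
  flux c phi x / (c - k ^ 2).

Lemma intermediate_value (phi : R -> R) (k x0 y : R) :
  smooth phi -> is_lim phi p_infty k -> phi x0 < y < k ->
  exists x, phi x = y.
Proof.
  intros H hk hy.
  destruct (lim_p_infty_eps _ _ (k - y) hk) as [N hN]; [lra|].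
  specialize (hN (N + 1) ltac:(lra)). apply Rabs_def2 in hN.
  destruct (IVT_gen phi x0 (N + 1) y) as [x [_ e]]; [| |now exists x].
  - intros x. apply (derivable_continuity_pt phi (Derive phi)).
    now apply smooth_derive.
  - split.
    + eapply Rle_trans; [apply Rmin_l|]. lra.
    + eapply Rle_trans; [|apply Rmax_r]. lra.
Qed.

Lemma wave_off_background (c k : R) (phi : R -> R) :
  solitary_wave c k phi -> exists x, phi x <> k.
Proof.
  intros [_ [[x [y hxy]] _]].
  destruct (Req_dec (phi x) k) as [e | ne]; [exists y | now exists x]. congruence.
Qed.

Lemma wave_peak (c k x1 : R) (phi : R -> R) :
  solitary_wave c k phi -> k < phi x1 ->
  exists x0, Derive phi x0 = 0 /\ forall x, phi x <= phi x0.
Proof.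
  intros [H [_ [_ [hp hm]]]] h.
  apply (peak_exists phi (Derive phi) k x1); auto.
  intros; now apply smooth_derive.
Qed.

Lemma wave_trough (c k x1 : R) (phi : R -> R) :
  solitary_wave c k phi -> phi x1 < k ->
  exists x0, Derive phi x0 = 0 /\ forall x, phi x0 <= phi x.
Proof.
  intros [H [_ [_ [hp hm]]]] h.
  destruct (peak_exists (fun x => - phi x) (fun x => - Derive phi x) (- k) x1)
    as [x0 [h0 hx0]].
  - intros x. apply (is_derive_opp phi). now apply smooth_derive.
  - exact (is_lim_opp _ _ _ hp).
  - exact (is_lim_opp _ _ _ hm).
  - lra.
  - exists x0. split; [lra|]. intros x. specialize (hx0 x). lra.
Qed.

(** For [c = k^2] the flux vanishes and [phi'^2 = phi^2 - k^2]: an extremum other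
    than [k] can only be [- k], and the wave would have to cross the forbidden
    strip [|phi| < k]. *)
Lemma wave_flux_at_infinity_neq_0 (c k : R) (phi : R -> R) :
  0 < k -> solitary_wave c k phi -> c - k ^ 2 <> 0.
Proof.
  intros hk W w0. assert (W' := W). destruct W' as [H [_ [_ [hp _]]]].
  destruct (wave_invariants c k phi W) as [_ inv].
  assert (slope : forall x, Derive phi x ^ 2 = phi x ^ 2 - k ^ 2).
  { intros x. destruct (inv x) as [e _]. rewrite w0 in e.
    assert (f0 : flux c phi x = 0) by nra. unfold flux in f0. lra. }
  destruct (wave_off_background c k phi W) as [x1 h1].
  destruct (Rdichotomy _ _ h1) as [h | h].
  - destruct (wave_trough c k x1 phi W h) as [x0 [d hx0]].
    assert (s0 := slope x0). rewrite d in s0. specialize (hx0 x1).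
    assert (phi x0 < 0) by nra.
    destruct (intermediate_value phi k x0 0 H hp) as [z ez]; [lra|].
    specialize (slope z). rewrite ez in slope.
    generalize (pow2_ge_0 (Derive phi z)). nra.
  - destruct (wave_peak c k x1 phi W h) as [x0 [d hx0]].
    assert (s0 := slope x0). rewrite d in s0. specialize (hx0 x1). nra.
Qed.

Lemma rel_flux_relations (c k : R) (phi : R -> R) (x : R) :
  0 < k -> solitary_wave c k phi ->
  let v := rel_flux c k phi x in let w0 := c - k ^ 2 in
  0 < v /\ phi x = k + w0 * (1 - v ^ 2) / (4 * k) /\ mu phi x = k / v /\
  16 * k ^ 2 * Derive phi x ^ 2
    = w0 * (1 - v) ^ 2 * (w0 * (1 + v) ^ 2 - 8 * k ^ 2).
Proof.
  intros hk W v w0.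
  assert (ne : w0 <> 0) by exact (wave_flux_at_infinity_neq_0 c k phi hk W).
  destruct (wave_invariants c k phi W) as [P inv]. destruct (inv x) as [e s].
  specialize (P x). fold (flux c phi x) in P. fold w0 in P, e, s.
  assert (ew : flux c phi x = w0 * v)
    by (unfold v, rel_flux; fold w0; field; auto).
  rewrite ew in *.
  assert (vne : v <> 0).
  { intros z. rewrite z in P. ring_simplify in P. symmetry in P.
    apply Rmult_integral in P. lra. }
  assert (sq : 0 < w0 ^ 2) by (apply pow2_gt_0; auto).
  assert (vpos : 0 < v).
  { assert (0 <= v); [|lra].
    apply (Rmult_le_reg_l (w0 ^ 2)); auto. rewrite Rmult_0_r.
    replace (w0 ^ 2 * v) with (w0 * (w0 * v)) by ring. exact s. }
  assert (ephi : phi x = k + w0 * (1 - v ^ 2) / (4 * k)).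
  { apply (Rmult_eq_reg_l (4 * k * w0)).
    - replace (4 * k * w0 * (k + w0 * (1 - v ^ 2) / (4 * k)))
        with (4 * k ^ 2 * w0 + w0 ^ 2 - (w0 * v) ^ 2) by (field; lra).
      rewrite e. ring.
    - apply Rmult_integral_contrapositive. split; auto. lra. }
  repeat split; auto.
  - apply (Rmult_eq_reg_r (w0 * v)); [rewrite P; field; auto|].
    now apply Rmult_integral_contrapositive.
  - replace (Derive phi x ^ 2) with (w0 * v + phi x ^ 2 - c)
      by (rewrite <- ew; unfold flux; ring).
    rewrite ephi. replace c with (w0 + k ^ 2) by (unfold w0; ring).
    field. lra.
Qed.

(** At a critical point off the background the second factor of the squared
    slope vanishes. *)
Lemma rel_flux_critical (c k : R) (phi : R -> R) (x : R) :
  0 < k -> solitary_wave c k phi -> Derive phi x = 0 -> phi x <> k ->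
  (c - k ^ 2) * (1 + rel_flux c k phi x) ^ 2 = 8 * k ^ 2.
Proof.
  intros hk W d ne.
  destruct (rel_flux_relations c k phi x hk W) as [vp [ephi [_ sl]]].
  set (v := rel_flux c k phi x) in *. set (w0 := c - k ^ 2) in *.
  rewrite d in sl.
  assert (w0 <> 0) by exact (wave_flux_at_infinity_neq_0 c k phi hk W).
  assert (1 - v <> 0).
  { intros z. apply ne. rewrite ephi. replace v with 1 by lra. field. lra. }
  assert (w0 * (1 - v) ^ 2 * (w0 * (1 + v) ^ 2 - 8 * k ^ 2) = 0) by lra.
  apply Rmult_integral in H1. destruct H1 as [z | z]; [|lra].
  exfalso. apply Rmult_integral in z. destruct z as [z | z]; [auto|].
  now apply (pow_nonzero _ 2) in H0.
Qed.

(** A trough would have relative flux [v0 > 1] with [(c - k^2) (1 + v0)^2 = 8 k^2],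
    but then the squared slope would be negative for the values of the flux
    strictly between [1] and [v0], which are taken on the way to infinity. *)
Lemma wave_above_background_weak (c k : R) (phi : R -> R) (x : R) :
  0 < k -> solitary_wave c k phi -> k <= phi x.
Proof.
  intros hk W. destruct (Rle_lt_dec k (phi x)) as [l | l]; auto. exfalso.
  destruct (wave_trough c k x phi W l) as [x0 [d hx0]].
  specialize (hx0 x).
  assert (cr := rel_flux_critical c k phi x0 hk W d ltac:(lra)).
  destruct W as [H [n [p [hp hm]]]].
  destruct (intermediate_value phi k x0 ((phi x0 + k) / 2) H hp) as [z ez]; [lra|].
  assert (W : solitary_wave c k phi) by (repeat split; auto).
  destruct (rel_flux_relations c k phi x0 hk W) as [vp0 [ephi0 _]].
  destruct (rel_flux_relations c k phi z hk W) as [vpz [ephiz [_ slz]]].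
  set (v0 := rel_flux c k phi x0) in *. set (v := rel_flux c k phi z) in *.
  set (w0 := c - k ^ 2) in *.
  assert (w0p : 0 < w0) by nra.
  assert (e0 : 4 * k * (phi x0 - k) = w0 * (1 - v0 ^ 2))
    by (rewrite ephi0; field; lra).
  assert (e1 : 4 * k * (phi z - k) = w0 * (1 - v ^ 2))
    by (rewrite ephiz; field; lra).
  assert (lt1 : 1 < v).
  { apply Rnot_le_lt. intros l1.
    assert (0 <= w0 * (1 - v ^ 2)) by (apply Rmult_le_pos; nra). nra. }
  assert (lt2 : v < v0).
  { apply Rnot_le_lt. intros l1.
    assert (w0 * (1 - v ^ 2) <= w0 * (1 - v0 ^ 2))
      by (apply Rmult_le_compat_l; nra). nra. }
  assert (0 < w0 * (1 - v) ^ 2) by (apply Rmult_lt_0_compat; auto; nra).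
  assert (w0 * (1 + v) ^ 2 - 8 * k ^ 2 < 0) by (rewrite <- cr; nra).
  generalize (pow2_ge_0 (Derive phi z)) (pow2_gt_0 k ltac:(lra)). nra.
Qed.

(** A wave is not identically [k] and has no trough, so it has a peak above [k].
    The critical-point equation at the peak is what forces [k^2 < c]. *)
Lemma wave_crest (c k : R) (phi : R -> R) :
  0 < k -> solitary_wave c k phi ->
  0 < c - k ^ 2 /\ exists x0, k < phi x0 /\ (forall x, phi x <= phi x0) /\
    rel_flux c k phi x0 < 1 /\
    (c - k ^ 2) * (1 + rel_flux c k phi x0) ^ 2 = 8 * k ^ 2.
Proof.
  intros hk W. destruct (wave_off_background c k phi W) as [x1 h1].
  assert (l1 : k < phi x1)
    by (generalize (wave_above_background_weak c k phi x1 hk W); lra).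
  destruct (wave_peak c k x1 phi W l1) as [x0 [d hx0]].
  assert (l0 : k < phi x0) by (specialize (hx0 x1); lra).
  assert (cr := rel_flux_critical c k phi x0 hk W d ltac:(lra)).
  destruct (rel_flux_relations c k phi x0 hk W) as [vp [ephi _]].
  assert (w0p : 0 < c - k ^ 2) by nra.
  split; auto. exists x0. repeat split; auto.
  assert (e0 : 4 * k * (phi x0 - k) = (c - k ^ 2) * (1 - rel_flux c k phi x0 ^ 2))
    by (rewrite ephi at 1; field; lra).
  apply Rnot_le_lt. intros l2.
  assert (0 <= (c - k ^ 2) * (rel_flux c k phi x0 ^ 2 - 1))
    by (apply Rmult_le_pos; nra).
  nra.
Qed.

Lemma background_range_iff (c k : R) :
  0 < c -> 0 < k ->
  (sqrt c / 3 < k < sqrt (3 * c) / 3 <->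
   c - k ^ 2 < 8 * k ^ 2 /\ 8 * k ^ 2 < 4 * (c - k ^ 2)).
Proof.
  intros hc hk.
  assert (p1 := sqrt_pos c). assert (p2 := sqrt_pos (3 * c)).
  assert (s1 := pow2_sqrt c ltac:(lra)). assert (s2 := pow2_sqrt (3 * c) ltac:(lra)).
  split; intros [h1 h2]; split; nra.
Qed.

(** The two bounds are [v > 0] and [v < 1] at the crest. *)
Lemma wave_range (c k : R) (phi : R -> R) :
  0 < k -> solitary_wave c k phi ->
  c - k ^ 2 < 8 * k ^ 2 /\ 8 * k ^ 2 < 4 * (c - k ^ 2).
Proof.
  intros hk W. destruct (wave_crest c k phi hk W) as [w0p [x0 [_ [_ [v1 cr]]]]].
  destruct (rel_flux_relations c k phi x0 hk W) as [vp _].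
  set (v := rel_flux c k phi x0) in *. set (w0 := c - k ^ 2) in *.
  assert (0 < w0 * ((1 + v) ^ 2 - 1)) by (apply Rmult_lt_0_compat; nra).
  assert (0 < w0 * (4 - (1 + v) ^ 2)) by (apply Rmult_lt_0_compat; nra).
  lra.
Qed.

Lemma wave_height (c k : R) (phi : R -> R) :
  0 < k -> solitary_wave c k phi ->
  exists x0, phi x0 = sqrt (2 * (c - k ^ 2)) - k /\ forall x, phi x <= phi x0.
Proof.
  intros hk W. destruct (wave_crest c k phi hk W) as [w0p [x0 [_ [hx0 [v1 cr]]]]].
  destruct (rel_flux_relations c k phi x0 hk W) as [vp [ephi _]].
  exists x0. split; auto. rewrite ephi.
  set (v := rel_flux c k phi x0) in *. set (w0 := c - k ^ 2) in *.
  (* [2 w0 = (w0 (1 + v) / (2 k))^2] is the crest equation times [w0 / (4 k^2)] *)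
  replace (2 * w0) with ((w0 * (1 + v) / (2 * k)) ^ 2).
  2: { apply (Rmult_eq_reg_r (4 * k ^ 2)); [|nra].
       replace ((w0 * (1 + v) / (2 * k)) ^ 2 * (4 * k ^ 2))
         with (w0 * (w0 * (1 + v) ^ 2)) by (field; lra).
       rewrite cr. ring. }
  rewrite sqrt_pow2.
  2: { apply Rlt_le, Rdiv_lt_0_compat; nra. }
  apply (Rmult_eq_reg_l (4 * k)); [|lra].
  replace (4 * k * (k + w0 * (1 - v ^ 2) / (4 * k)))
    with (4 * k ^ 2 + w0 * (1 - v ^ 2)) by (field; lra).
  replace (4 * k * (w0 * (1 + v) / (2 * k) - k))
    with (2 * w0 * (1 + v) - 4 * k ^ 2) by (field; lra).
  lra.
Qed.

(** Since [phi'^2 <= 4 (phi - k)^2], a wave that touches its background never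
    leaves it. *)
Lemma wave_above_background (c k : R) (phi : R -> R) (x : R) :
  0 < k -> solitary_wave c k phi -> k < phi x.
Proof.
  intros hk W.
  destruct (Rle_lt_or_eq_dec _ _ (wave_above_background_weak c k phi x hk W))
    as [l | e]; auto. exfalso.
  destruct (wave_crest c k phi hk W) as [w0p _].
  destruct (wave_off_background c k phi W) as [x1 h1]. apply h1.
  assert (H := proj1 W).
  apply Rminus_diag_uniq.
  apply (zero_propagates (fun y => phi y - k) (Derive phi) 2 x); [| | |lra].
  - intros y. evar_last.
    + apply (is_derive_minus phi (fun _ => k)); [now apply smooth_derive|].
      apply (@is_derive_const R_AbsRing R_NormedModule).
    + unfold minus, plus, opp, zero; simpl. ring.
  - intros y. generalize (wave_above_background_weak c k phi y hk W). lra.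
  - intros y. assert (ge := wave_above_background_weak c k phi y hk W).
    destruct (rel_flux_relations c k phi y hk W) as [vp [ephi [_ sl]]].
    set (v := rel_flux c k phi y) in *. set (w0 := c - k ^ 2) in *.
    assert (e0 : 4 * k * (phi y - k) = w0 * (1 - v ^ 2))
      by (rewrite ephi; field; lra).
    assert (v1 : v <= 1).
    { apply Rnot_lt_le. intros l1.
      assert (0 < w0 * (v ^ 2 - 1)) by (apply Rmult_lt_0_compat; nra). nra. }
    rewrite <- (Rabs_right (2 * (phi y - k))) by lra.
    apply Rsqr_le_abs_0. unfold Rsqr.
    apply (Rmult_le_reg_l (16 * k ^ 2)); [nra|].
    replace (16 * k ^ 2 * (Derive phi y * Derive phi y))
      with (16 * k ^ 2 * Derive phi y ^ 2) by ring.
    replace (16 * k ^ 2 * (2 * (phi y - k) * (2 * (phi y - k))))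
      with (4 * (4 * k * (phi y - k)) ^ 2) by ring.
    rewrite sl, e0.
    replace (4 * (w0 * (1 - v ^ 2)) ^ 2)
      with (w0 * (1 - v) ^ 2 * (4 * w0 * (1 + v) ^ 2)) by ring.
    apply Rmult_le_compat_l; [|nra].
    apply Rmult_le_pos; [lra | apply pow2_ge_0].
Qed.

(** * Desingularised orbits *)

(** The relation [4 (v v')^2 = (1 - v)^2 ((1 + v)^2 - B^2)] for the relative flux
    is singular at the crest, where the square root of the right-hand side
    changes sign. The signed root [u = 2 v v' / (1 - v)] is a regular, strictly
    increasing parameter of the whole orbit. *)
Record flux_orbit (B : R) (u v : R -> R) : Prop := {
  orbit_range : forall x, 0 < v x < 1;
  orbit_hyperbola : forall x, u x ^ 2 + B ^ 2 = (1 + v x) ^ 2;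
  orbit_derive_u : forall x, is_derive u x ((1 - v x ^ 2) / (2 * v x));
  orbit_derive_v : forall x, is_derive v x (u x * (1 - v x) / (2 * v x)) }.

Definition flux_of_root (B u : R) : R := sqrt (u ^ 2 + B ^ 2) - 1.

(** This is [U tanh (t / 2)]. The value [U = sqrt (4 - B^2)] used below is that
    of [|u|] at the background [v = 1]. *)
Definition squash (U t : R) : R := U * (1 - 2 / (1 + exp t)).

(** In the coordinate [t] with [u = U tanh (t / 2)], the factor [1 - v] of the
    equation for [u] cancels against [U^2 - u^2 = (1 - v) (3 + v)]; what is left
    is bounded above and away from zero. *)
Definition orbit_speed (B t : R) : R :=
  let U := sqrt (4 - B ^ 2) in
  let v := flux_of_root B (squash U t) in
  U * (1 + v) / (v * (3 + v)).

Lemma half_width_pos (B : R) : 1 < B < 2 -> 0 < sqrt (4 - B ^ 2).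
Proof. intros h. apply sqrt_lt_R0. nra. Qed.

Lemma half_width_sq (B : R) : 1 < B < 2 -> sqrt (4 - B ^ 2) ^ 2 = 4 - B ^ 2.
Proof. intros h. apply pow2_sqrt. nra. Qed.

Lemma squash_defect (U t : R) :
  U ^ 2 - squash U t ^ 2 = 4 * U ^ 2 * (exp t / (1 + exp t) ^ 2).
Proof. unfold squash. generalize (exp_pos t). intros. field. lra. Qed.

Lemma exp_defect_bound (t : R) :
  0 < exp t / (1 + exp t) ^ 2 <= / (1 + Rabs t).
Proof.
  assert (p := exp_pos t). split; [apply Rdiv_lt_0_compat; nra|].
  assert (q := exp_ineq1_le t). assert (q' := exp_ineq1_le (- t)).
  rewrite exp_Ropp in q'.
  assert (a := Rabs_pos t).
  apply (Rmult_le_reg_r ((1 + exp t) ^ 2 * (1 + Rabs t))); [nra|].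
  replace (exp t / (1 + exp t) ^ 2 * ((1 + exp t) ^ 2 * (1 + Rabs t)))
    with (exp t * (1 + Rabs t)) by (field; lra).
  replace (/ (1 + Rabs t) * ((1 + exp t) ^ 2 * (1 + Rabs t)))
    with ((1 + exp t) ^ 2) by (field; lra).
  unfold Rabs in *. destruct (Rcase_abs t).
  - apply (Rmult_le_compat_l (exp t)) in q'; [|lra].
    rewrite Rinv_r in q' by lra. nra.
  - nra.
Qed.

Lemma flux_of_root_squash (B t : R) :
  1 < B < 2 -> let u := squash (sqrt (4 - B ^ 2)) t in
  let v := flux_of_root B u in
  B - 1 <= v < 1 /\ u ^ 2 + B ^ 2 = (1 + v) ^ 2.
Proof.
  intros h u v. assert (d := squash_defect (sqrt (4 - B ^ 2)) t). fold u in d.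
  assert (Up := half_width_pos B h). assert (Us := half_width_sq B h).
  destruct (exp_defect_bound t) as [e _].
  assert (lt : u ^ 2 + B ^ 2 < 4).
  { apply (Rmult_lt_compat_l (4 * sqrt (4 - B ^ 2) ^ 2)) in e; nra. }
  assert (sq : u ^ 2 + B ^ 2 = (1 + v) ^ 2).
  { unfold v, flux_of_root. rewrite <- (pow2_sqrt (u ^ 2 + B ^ 2)) at 1 by nra.
    ring. }
  assert (0 <= 1 + v)
    by (generalize (sqrt_pos (u ^ 2 + B ^ 2)); unfold v, flux_of_root; lra).
  repeat split; auto; nra.
Qed.

Lemma orbit_speed_bounds (B t : R) :
  1 < B < 2 ->
  sqrt (4 - B ^ 2) / 4 <= orbit_speed B t <= sqrt (4 - B ^ 2) / (B - 1).
Proof.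
  intros h. destruct (flux_of_root_squash B t h) as [hv _].
  assert (Up := half_width_pos B h).
  unfold orbit_speed. set (U := sqrt (4 - B ^ 2)) in *.
  set (v := flux_of_root B (squash U t)) in *. split.
  - apply (Rmult_le_reg_r (4 * (v * (3 + v)))); [nra|].
    replace (U / 4 * (4 * (v * (3 + v)))) with (U * (v * (3 + v))) by field.
    replace (U * (1 + v) / (v * (3 + v)) * (4 * (v * (3 + v))))
      with (U * (4 * (1 + v))) by (field; lra).
    apply Rmult_le_compat_l; nra.
  - apply (Rmult_le_reg_r ((B - 1) * (v * (3 + v))));
      [apply Rmult_lt_0_compat; nra|].
    replace (U * (1 + v) / (v * (3 + v)) * ((B - 1) * (v * (3 + v))))
      with (U * ((1 + v) * (B - 1))) by (field; lra).
    replace (U / (B - 1) * ((B - 1) * (v * (3 + v))))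
      with (U * (v * (3 + v))) by (field; lra).
    apply Rmult_le_compat_l; nra.
Qed.

Lemma orbit_speed_pos (B t : R) : 1 < B < 2 -> 0 < orbit_speed B t.
Proof.
  intros h. generalize (orbit_speed_bounds B t h) (half_width_pos B h). lra.
Qed.

Lemma orbit_speed_continuous (B t : R) : 1 < B < 2 -> continuous (orbit_speed B) t.
Proof.
  intros h. destruct (flux_of_root_squash B t h) as [hv _].
  apply (ex_derive_continuous (orbit_speed B) t).
  unfold orbit_speed, flux_of_root, squash in *.
  assert (p := exp_pos t).
  assert (pos : forall y, 0 < y * (y * 1) + B * (B * 1)) by (intros; nra).
  auto_derive. unfold Rdiv, Rminus in *. simpl in *.
  repeat split; try apply pos; try lra.
  apply Rmult_integral_contrapositive; split; lra.
Qed.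

Lemma flux_orbit_of_speed (B : R) (t : R -> R) :
  1 < B < 2 -> (forall x, is_derive t x (orbit_speed B (t x))) ->
  flux_orbit B (fun x => squash (sqrt (4 - B ^ 2)) (t x))
    (fun x => flux_of_root B (squash (sqrt (4 - B ^ 2)) (t x))).
Proof.
  intros h dt. assert (Up := half_width_pos B h). assert (Us := half_width_sq B h).
  set (U := sqrt (4 - B ^ 2)) in *.
  assert (du : forall x, let v := flux_of_root B (squash U (t x)) in
    is_derive (fun x => squash U (t x)) x ((1 - v ^ 2) / (2 * v))).
  { intros x v. destruct (flux_of_root_squash B (t x) h) as [hv hy].
    fold U in hv, hy. fold v in hv, hy.
    assert (d := squash_defect U (t x)). assert (p := exp_pos (t x)).
    evar_last.
    - apply (is_derive_comp (squash U) t x (2 * U * exp (t x) / (1 + exp (t x)) ^ 2)).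
      + unfold squash. auto_derive; [lra | field; lra].
      + apply dt.
    - change (U * (1 + v) / (v * (3 + v)) * (2 * U * exp (t x) / (1 + exp (t x)) ^ 2)
              = (1 - v ^ 2) / (2 * v)).
      (* the hyperbola and [U^2 = 4 - B^2] give [U^2 - u^2 = (1 - v) (3 + v)] *)
      assert (e : 4 * (U * U * (exp (t x) / (1 + exp (t x)) ^ 2))
                  = (1 - v) * (3 + v)) by nra.
      transitivity ((1 - v) * (3 + v) * ((1 + v) / (2 * v * (3 + v))));
        [|field; lra].
      rewrite <- e. field. repeat split; lra. }
  constructor.
  - intros x. destruct (flux_of_root_squash B (t x) h) as [hv _].
    fold U in hv. lra.
  - intros x. destruct (flux_of_root_squash B (t x) h) as [_ hy]. exact hy.
  - exact du.
  - intros x. set (v := flux_of_root B (squash U (t x))).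
    destruct (flux_of_root_squash B (t x) h) as [hv hy].
    fold U in hv, hy. fold v in hv, hy.
    assert (pos : 0 < squash U (t x) ^ 2 + B ^ 2) by (rewrite hy; nra).
    assert (sv : sqrt (squash U (t x) ^ 2 + B ^ 2) = 1 + v)
      by (unfold v, flux_of_root; ring).
    evar_last.
    + apply (is_derive_comp (flux_of_root B) (fun x => squash U (t x)) x
               (squash U (t x) / (1 + v))).
      * unfold flux_of_root. auto_derive; [simpl in pos; lra|].
        simpl in sv. rewrite sv. field. lra.
      * apply du.
    + change ((1 - v ^ 2) / (2 * v) * (squash U (t x) / (1 + v))
              = squash U (t x) * (1 - v) / (2 * v)).
      field. split; lra.
Qed.

Lemma inverse_linear_lim (m C : R) (f : R -> R) (l : R) :
  0 < m -> 0 < C -> (forall x, Rabs (f x - l) <= C * / (1 + m * Rabs x)) ->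
  is_lim f p_infty l /\ is_lim f m_infty l.
Proof.
  intros hm hC hf.
  assert (small : forall eps x, 0 < eps -> C / (m * eps) < Rabs x ->
    Rabs (f x - l) < eps).
  { intros eps x he hx. eapply Rle_lt_trans; [apply hf|].
    assert (0 < C / (m * eps)) by (apply Rdiv_lt_0_compat; nra).
    apply (Rmult_lt_compat_l (m * eps)) in hx; [|nra].
    replace (m * eps * (C / (m * eps))) with C in hx by (field; lra).
    assert (0 < 1 + m * Rabs x) by nra.
    apply (Rmult_lt_reg_r (1 + m * Rabs x)); auto.
    rewrite Rmult_assoc, Rinv_l by lra. nra. }
  split; apply is_lim_spec; intros eps;
    assert (pos : 0 < C / (m * eps))
      by (apply Rdiv_lt_0_compat; auto; apply Rmult_lt_0_compat;
          auto; apply cond_pos).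
  - exists (C / (m * eps)). intros x hx. apply small; [apply cond_pos|].
    rewrite Rabs_right; lra.
  - exists (- (C / (m * eps))). intros x hx. apply small; [apply cond_pos|].
    rewrite Rabs_left; lra.
Qed.

(** The coordinate [t] grows at least linearly and [1 - v] is exponentially small
    in [t], so a crude algebraic bound gives the limits. *)
Lemma flux_orbit_exists (B : R) :
  1 < B < 2 -> exists u v, flux_orbit B u v /\ u 0 = 0 /\
    is_lim v p_infty 1 /\ is_lim v m_infty 1.
Proof.
  intros h.
  destruct (autonomous_exists (orbit_speed B) (sqrt (4 - B ^ 2) / (B - 1)))
    as [t [t0 dt]].
  { intros; now apply orbit_speed_continuous. }
  { intros; split; [now apply orbit_speed_pos | now apply orbit_speed_bounds]. }
  assert (O := flux_orbit_of_speed B t h dt).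
  assert (Up := half_width_pos B h). assert (Us := half_width_sq B h).
  set (U := sqrt (4 - B ^ 2)) in *.
  exists (fun x => squash U (t x)), (fun x => flux_of_root B (squash U (t x))).
  split; [exact O|]. split; [rewrite t0; unfold squash; rewrite exp_0; field|].
  assert (grow : forall x, U / 4 * Rabs x <= Rabs (t x)).
  { intros x. destruct (Rtotal_order x 0) as [l | [-> | l]].
    - destruct (mean_value t _ x 0 dt l) as [z [_ e]]. rewrite t0 in e.
      destruct (orbit_speed_bounds B (t z) h) as [b _]. fold U in b.
      rewrite (Rabs_left x) by auto. rewrite <- Rabs_Ropp.
      eapply Rle_trans; [|apply Rle_abs]. nra.
    - rewrite Rabs_R0. generalize (Rabs_pos (t 0)). lra.
    - destruct (mean_value t _ 0 x dt l) as [z [_ e]]. rewrite t0 in e.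
      destruct (orbit_speed_bounds B (t z) h) as [b _]. fold U in b.
      rewrite (Rabs_right x) by lra.
      eapply Rle_trans; [|apply Rle_abs]. nra. }
  apply (inverse_linear_lim (U / 4) (4 * U ^ 2)); [lra | nra |].
  intros x. set (v := flux_of_root B (squash U (t x))).
  assert (hv := orbit_range _ _ _ O x). assert (hy := orbit_hyperbola _ _ _ O x).
  simpl in hv. cbv beta in hy. fold v in hv, hy.
  assert (d := squash_defect U (t x)).
  destruct (exp_defect_bound (t x)) as [_ b].
  rewrite Rabs_left by lra.
  apply Rle_trans with (4 * U ^ 2 * / (1 + Rabs (t x))).
  - apply Rle_trans with (4 * U ^ 2 * (exp (t x) / (1 + exp (t x)) ^ 2)); [nra|].
    apply Rmult_le_compat_l; [nra | exact b].
  - apply Rmult_le_compat_l; [nra|]. apply Rinv_le_contravar.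
    + generalize (Rabs_pos x). nra.
    + specialize (grow x). lra.
Qed.

Definition unsquash (U u : R) : R := ln ((U + u) / (U - u)).

Lemma squash_unsquash (U u : R) : - U < u < U -> squash U (unsquash U u) = u.
Proof.
  intros h. unfold squash, unsquash. rewrite exp_ln.
  - field. repeat split; lra.
  - apply Rdiv_lt_0_compat; lra.
Qed.

Lemma flux_orbit_root_bound (B : R) (u v : R -> R) (x : R) :
  1 < B < 2 -> flux_orbit B u v ->
  - sqrt (4 - B ^ 2) < u x < sqrt (4 - B ^ 2).
Proof.
  intros h O. assert (Up := half_width_pos B h). assert (Us := half_width_sq B h).
  assert (hv := orbit_range _ _ _ O x). assert (hy := orbit_hyperbola _ _ _ O x).
  assert (u x ^ 2 < sqrt (4 - B ^ 2) ^ 2) by nra. split; nra.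
Qed.

Lemma flux_of_root_orbit (B : R) (u v : R -> R) (x : R) :
  flux_orbit B u v -> flux_of_root B (u x) = v x.
Proof.
  intros O. unfold flux_of_root. rewrite (orbit_hyperbola _ _ _ O).
  assert (hv := orbit_range _ _ _ O x). rewrite sqrt_pow2; lra.
Qed.

Lemma unsquash_derive (B : R) (u v : R -> R) (x : R) :
  1 < B < 2 -> flux_orbit B u v -> let U := sqrt (4 - B ^ 2) in
  is_derive (fun x => unsquash U (u x)) x (orbit_speed B (unsquash U (u x))).
Proof.
  intros h O U. assert (Up := half_width_pos B h). assert (Us := half_width_sq B h).
  assert (hu := flux_orbit_root_bound B u v x h O).
  assert (hv := orbit_range _ _ _ O x). assert (hy := orbit_hyperbola _ _ _ O x).
  fold U in Up, Us, hu.
  unfold orbit_speed. fold U. rewrite squash_unsquash by auto.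
  rewrite (flux_of_root_orbit B u v x O).
  evar_last.
  - apply (is_derive_comp (unsquash U) u x (2 * U / ((U + u x) * (U - u x)))).
    + unfold unsquash. auto_derive.
      * repeat split; try lra. apply Rdiv_lt_0_compat; lra.
      * field. repeat split; lra.
    + apply (orbit_derive_u _ _ _ O).
  - unfold scal; simpl; unfold mult; simpl.
    replace ((U + u x) * (U - u x)) with ((1 - v x) * (3 + v x)) by nra.
    field. repeat split; lra.
Qed.

Lemma flux_orbit_unique (B : R) (u1 v1 u2 v2 : R -> R) :
  1 < B < 2 -> flux_orbit B u1 v1 -> flux_orbit B u2 v2 -> u1 0 = u2 0 ->
  forall x, v1 x = v2 x.
Proof.
  intros h O1 O2 e x.
  assert (t := autonomous_unique (orbit_speed B)
    (fun x => unsquash (sqrt (4 - B ^ 2)) (u1 x))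
    (fun x => unsquash (sqrt (4 - B ^ 2)) (u2 x))
    (fun s => orbit_speed_continuous B s h) (fun s => orbit_speed_pos B s h)
    (fun x => unsquash_derive B u1 v1 x h O1)
    (fun x => unsquash_derive B u2 v2 x h O2)
    (f_equal (unsquash (sqrt (4 - B ^ 2))) e) x).
  cbv beta in t. apply (f_equal (squash (sqrt (4 - B ^ 2)))) in t.
  rewrite !squash_unsquash in t by (eapply flux_orbit_root_bound; eauto).
  rewrite <- (flux_of_root_orbit B u1 v1 x O1), <- (flux_of_root_orbit B u2 v2 x O2).
  now rewrite t.
Qed.

(** * Correspondence between orbits and solitary waves *)

(** The value of [1 + v] at the crest. *)
Definition crest_parameter (c k : R) : R := sqrt (8 * k ^ 2 / (c - k ^ 2)).

Lemma crest_parameter_spec (c k : R) :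
  0 < k -> c - k ^ 2 < 8 * k ^ 2 -> 8 * k ^ 2 < 4 * (c - k ^ 2) ->
  1 < crest_parameter c k < 2 /\
  (c - k ^ 2) * crest_parameter c k ^ 2 = 8 * k ^ 2.
Proof.
  intros hk h1 h2. assert (w0p : 0 < c - k ^ 2) by nra.
  assert (pos : 0 <= 8 * k ^ 2 / (c - k ^ 2))
    by (apply Rlt_le, Rdiv_lt_0_compat; nra).
  assert (sq := pow2_sqrt _ pos). assert (p := sqrt_pos (8 * k ^ 2 / (c - k ^ 2))).
  fold (crest_parameter c k) in *.
  assert (e : (c - k ^ 2) * crest_parameter c k ^ 2 = 8 * k ^ 2)
    by (rewrite sq; field; lra).
  set (B := crest_parameter c k) in *.
  assert (b1 : 1 < B ^ 2) by (apply (Rmult_lt_reg_l (c - k ^ 2)); lra).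
  assert (b2 : B ^ 2 < 4) by (apply (Rmult_lt_reg_l (c - k ^ 2)); lra).
  repeat split; auto; nra.
Qed.

(** This is [2 v v' / (1 - v)], as [phi' = - (c - k^2) v v' / (2 k)]. *)
Definition wave_root (c k : R) (phi : R -> R) (x : R) : R :=
  - 4 * k * Derive phi x / ((c - k ^ 2) * (1 - rel_flux c k phi x)).

Lemma rel_flux_lt_1 (c k : R) (phi : R -> R) (x : R) :
  0 < k -> solitary_wave c k phi -> rel_flux c k phi x < 1.
Proof.
  intros hk W. assert (g := wave_above_background c k phi x hk W).
  destruct (wave_crest c k phi hk W) as [w0p _].
  destruct (rel_flux_relations c k phi x hk W) as [vp [ephi _]].
  set (v := rel_flux c k phi x) in *. set (w0 := c - k ^ 2) in *.
  assert (e0 : 4 * k * (phi x - k) = w0 * (1 - v ^ 2))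
    by (rewrite ephi; field; lra).
  apply Rnot_le_lt. intros l.
  assert (0 <= w0 * (v ^ 2 - 1)) by (apply Rmult_le_pos; nra). nra.
Qed.

(** The derivative of [u] is computed from the second-order equation
    [phi'' = phi - k / v], which stays informative at the crest. *)
Lemma wave_flux_orbit (c k : R) (phi : R -> R) :
  0 < k -> solitary_wave c k phi ->
  flux_orbit (crest_parameter c k) (wave_root c k phi) (rel_flux c k phi).
Proof.
  intros hk W.
  destruct (wave_range c k phi hk W) as [r1 r2].
  destruct (crest_parameter_spec c k hk r1 r2) as [_ eB].
  assert (w0p : 0 < c - k ^ 2) by nra.
  assert (H := proj1 W).
  set (B := crest_parameter c k) in *. set (v := rel_flux c k phi).
  set (u := wave_root c k phi).
  assert (eD : forall x, Derive phi x = - (c - k ^ 2) * u x * (1 - v x) / (4 * k)).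
  { intros x. assert (v1 := rel_flux_lt_1 c k phi x hk W).
    unfold u, wave_root. fold v in v1 |- *. field. repeat split; lra. }
  assert (hyp : forall x, u x ^ 2 + B ^ 2 = (1 + v x) ^ 2).
  { intros x. assert (v1 := rel_flux_lt_1 c k phi x hk W).
    destruct (rel_flux_relations c k phi x hk W) as [vp [_ [_ sl]]].
    fold v in v1, vp, sl. rewrite eD, <- eB in sl.
    apply (Rmult_eq_reg_l ((c - k ^ 2) ^ 2 * (1 - v x) ^ 2)).
    2: { apply Rmult_integral_contrapositive; split; apply pow_nonzero; lra. }
    replace (16 * k ^ 2 * (- (c - k ^ 2) * u x * (1 - v x) / (4 * k)) ^ 2)
      with ((c - k ^ 2) ^ 2 * (1 - v x) ^ 2 * u x ^ 2) in sl by (field; lra).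
    rewrite Rmult_plus_distr_l, sl. ring. }
  assert (dv : forall x, is_derive v x (u x * (1 - v x) / (2 * v x))).
  { intros x. destruct (rel_flux_relations c k phi x hk W) as [vp [_ [em _]]].
    fold v in vp, em. evar_last.
    - apply (is_derive_ext (fun x => / (c - k ^ 2) * flux c phi x)).
      { intros; unfold v, rel_flux, Rdiv. apply Rmult_comm. }
      apply (is_derive_scal (flux c phi) x). now apply flux_derive.
    - rewrite em, eD. field. repeat split; lra. }
  constructor; auto.
  - intros x. destruct (rel_flux_relations c k phi x hk W) as [vp _].
    split; auto. now apply rel_flux_lt_1.
  - intros x. assert (v1 := rel_flux_lt_1 c k phi x hk W).
    destruct (rel_flux_relations c k phi x hk W) as [vp [ephi [em _]]].
    fold v in v1, vp, em, ephi.
    assert (e2 : Derive_n phi 2 x = phi x - k / v x) by (rewrite <- em; unfold mu; ring).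
    assert (dd : is_derive (fun x => (c - k ^ 2) * (1 - v x)) x
                   (- (c - k ^ 2) * (u x * (1 - v x) / (2 * v x)))).
    { evar_last.
      - apply (is_derive_scal (fun x => 1 - v x) x (c - k ^ 2)).
        apply (is_derive_minus (fun _ => 1) v); [|apply dv].
        apply (@is_derive_const R_AbsRing R_NormedModule).
      - unfold minus, plus, opp, zero; simpl. ring. }
    evar_last.
    + apply (is_derive_div (fun x => - 4 * k * Derive phi x)
               (fun x => (c - k ^ 2) * (1 - v x)) x); [| exact dd |].
      * apply (is_derive_scal (Derive phi) x (- 4 * k)).
        now apply smooth_derive2.
      * apply Rmult_integral_contrapositive; split; lra.
    + rewrite e2, ephi, eD.
      assert (eu : u x ^ 2 = (1 + v x) ^ 2 - 8 * k ^ 2 / (c - k ^ 2)).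
      { rewrite <- (hyp x), <- eB. field. lra. }
      transitivity ((4 * k ^ 2 / (c - k ^ 2)) / v x - (1 + v x) + u x ^ 2 / (2 * v x)).
      * field. repeat split; lra.
      * rewrite eu. field. split; lra.
Qed.

Definition wave_of_flux (c k : R) (v : R -> R) (x : R) : R :=
  k + (c - k ^ 2) * (1 - v x ^ 2) / (4 * k).

(** The derivatives of [u], [v] and [1 / v] along an orbit are polynomials in
    [u], [v] and [1 / v]. *)
Lemma wave_of_flux_smooth (c k B : R) (u v : R -> R) :
  0 < k -> flux_orbit B u v -> smooth (wave_of_flux c k v).
Proof.
  intros hk O.
  set (gen := fun f : R -> R => f = u \/ f = v \/ f = (fun x => / v x)).
  assert (Au : algebra_of gen u) by (apply alg_gen; unfold gen; auto).
  assert (Av : algebra_of gen v) by (apply alg_gen; unfold gen; auto).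
  assert (Ai : algebra_of gen (fun x => / v x)) by (apply alg_gen; unfold gen; auto).
  assert (Ah : algebra_of gen (fun x => 1 / 2 * / v x))
    by (apply (alg_mult _ (fun _ => 1 / 2)); auto; apply alg_const).
  assert (Am : algebra_of gen (fun x => 1 + - 1 * v x)).
  { apply (alg_plus _ (fun _ => 1)); [apply alg_const|].
    apply (alg_mult _ (fun _ => - 1)); auto; apply alg_const. }
  assert (Adv : algebra_of gen (fun x => u x * (1 + - 1 * v x) * (1 / 2 * / v x))).
  { apply alg_mult; auto. now apply alg_mult. }
  assert (Av2 : algebra_of gen (fun x => 1 + - 1 * (v x * v x))).
  { apply (alg_plus _ (fun _ => 1)); [apply alg_const|].
    apply (alg_mult _ (fun _ => - 1)); [apply alg_const|]. now apply alg_mult. }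
  assert (S : forall f, algebra_of gen f -> smooth f).
  { apply algebra_of_smooth. intros f [-> | [-> | ->]].
    - exists (fun x => (1 + - 1 * (v x * v x)) * (1 / 2 * / v x)).
      split; [now apply alg_mult|]. intros x.
      assert (hv := orbit_range _ _ _ O x).
      evar_last; [apply (orbit_derive_u _ _ _ O)|]. field. lra.
    - exists (fun x => u x * (1 + - 1 * v x) * (1 / 2 * / v x)).
      split; [exact Adv|]. intros x.
      assert (hv := orbit_range _ _ _ O x).
      evar_last; [apply (orbit_derive_v _ _ _ O)|]. field. lra.
    - exists (fun x => - 1 * (u x * (1 + - 1 * v x) * (1 / 2 * / v x))
                       * (/ v x * / v x)).
      split.
      { apply alg_mult; [|now apply alg_mult].
        apply (alg_mult _ (fun _ => - 1)); auto; apply alg_const. }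
      intros x. assert (hv := orbit_range _ _ _ O x).
      evar_last.
      + apply (is_derive_inv v x _ (orbit_derive_v _ _ _ O x)). lra.
      + field. lra. }
  intros n x.
  apply (ex_derive_n_ext
           (fun x => k + (c - k ^ 2) / (4 * k) * (1 + - 1 * (v x * v x)))).
  { intros y. unfold wave_of_flux. field. lra. }
  apply S. apply (alg_plus _ (fun _ => k)); [apply alg_const|].
  apply (alg_mult _ (fun _ => (c - k ^ 2) / (4 * k))); auto; apply alg_const.
Qed.

Lemma wave_of_flux_derive (c k B : R) (u v : R -> R) (x : R) :
  0 < k -> flux_orbit B u v ->
  Derive (wave_of_flux c k v) x = - (c - k ^ 2) * u x * (1 - v x) / (4 * k).
Proof.
  intros hk O. apply is_derive_unique. assert (hv := orbit_range _ _ _ O x).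
  evar_last.
  - apply (is_derive_comp (fun y => k + (c - k ^ 2) * (1 - y ^ 2) / (4 * k)) v x
             (- (c - k ^ 2) * v x / (2 * k))).
    + auto_derive; [exact I | field; lra].
    + apply (orbit_derive_v _ _ _ O).
  - unfold scal; simpl; unfold mult; simpl. field. split; lra.
Qed.

Lemma wave_of_flux_profile_eq (c k B : R) (u v : R -> R) :
  0 < k -> (c - k ^ 2) * B ^ 2 = 8 * k ^ 2 -> flux_orbit B u v ->
  profile_eq c (k * (c - k ^ 2)) (wave_of_flux c k v).
Proof.
  intros hk eB O x. assert (hv := orbit_range _ _ _ O x).
  assert (hy := orbit_hyperbola _ _ _ O x).
  assert (w0 : c - k ^ 2 <> 0) by (intros z; rewrite z in eB; nra).
  assert (D1 := fun x => wave_of_flux_derive c k B u v x hk O).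
  assert (D2 : Derive_n (wave_of_flux c k v) 2 x = wave_of_flux c k v x - k / v x).
  { change (Derive (Derive (wave_of_flux c k v)) x = wave_of_flux c k v x - k / v x).
    rewrite (Derive_ext _ _ x D1). apply is_derive_unique.
    evar_last.
    - apply (is_derive_ext (fun x => - (c - k ^ 2) / (4 * k) * (u x * (1 - v x)))).
      { intros y. change (- (c - k ^ 2) / (4 * k) * (u y * (1 - v y))
                          = - (c - k ^ 2) * u y * (1 - v y) / (4 * k)).
        field. lra. }
      apply (is_derive_scal (fun x => u x * (1 - v x)) x).
      apply (is_derive_mult u (fun x => 1 - v x) x).
      + apply (orbit_derive_u _ _ _ O).
      + apply (is_derive_minus (fun _ => 1) v); [|apply (orbit_derive_v _ _ _ O)].
        apply (@is_derive_const R_AbsRing R_NormedModule).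
      + exact Rmult_comm.
    - unfold minus, plus, opp, mult, zero; simpl.
      unfold wave_of_flux.
      apply (Rmult_eq_reg_l (8 * k * v x)); [|nra].
      transitivity (- (c - k ^ 2) * (1 - v x) * (1 - v x ^ 2 - u x ^ 2)).
      + field. lra.
      + replace (u x ^ 2) with ((1 + v x) ^ 2 - B ^ 2) by lra.
        transitivity (2 * (c - k ^ 2) * (1 - v x) * (1 + v x) * v x
                      - (c - k ^ 2) * B ^ 2 * (1 - v x)); [ring|].
        rewrite eB. field. lra. }
  unfold mu. rewrite D2, D1. unfold wave_of_flux.
  transitivity (k / v x * ((c - k ^ 2) * v x)); [|field; lra].
  f_equal; [ring|].
  apply (Rmult_eq_reg_l (16 * k ^ 2)); [|nra].
  transitivity ((c - k ^ 2) ^ 2 * u x ^ 2 * (1 - v x) ^ 2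
     + 16 * k ^ 2 * (c - k ^ 2) - 8 * k ^ 2 * (c - k ^ 2) * (1 - v x ^ 2)
     - (c - k ^ 2) ^ 2 * (1 - v x ^ 2) ^ 2); [field; lra|].
  replace (u x ^ 2) with ((1 + v x) ^ 2 - B ^ 2) by lra.
  transitivity (- ((c - k ^ 2) * B ^ 2) * (c - k ^ 2) * (1 - v x) ^ 2
     + 16 * k ^ 2 * (c - k ^ 2) - 8 * k ^ 2 * (c - k ^ 2) * (1 - v x ^ 2)); [ring|].
  rewrite eB. ring.
Qed.

Lemma wave_exists (c k : R) :
  0 < k -> c - k ^ 2 < 8 * k ^ 2 -> 8 * k ^ 2 < 4 * (c - k ^ 2) ->
  exists phi, solitary_wave c k phi /\ Derive phi 0 = 0.
Proof.
  intros hk r1 r2. destruct (crest_parameter_spec c k hk r1 r2) as [hB eB].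
  destruct (flux_orbit_exists _ hB) as [u [v [O [u0 [lp lm]]]]].
  set (B := crest_parameter c k) in *.
  assert (L : forall p, is_lim v p 1 -> is_lim (wave_of_flux c k v) p k).
  { intros p l.
    replace (Finite k) with (Finite (k + (c - k ^ 2) * (1 - 1 ^ 2) / (4 * k)))
      by (f_equal; field; lra).
    apply (lim_comp_continuous v
      (fun y => k + (c - k ^ 2) * (1 - y ^ 2) / (4 * k))); auto.
    apply (ex_derive_continuous
      (fun y => k + (c - k ^ 2) * (1 - y ^ 2) / (4 * k))). now auto_derive. }
  exists (wave_of_flux c k v).
  split; [|rewrite (wave_of_flux_derive c k B u v 0 hk O), u0; field; lra].
  assert (hv := orbit_range _ _ _ O 0).
  assert (g : k < wave_of_flux c k v 0).
  { unfold wave_of_flux.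
    assert (0 < (c - k ^ 2) * (1 - v 0 ^ 2) / (4 * k)); [|lra].
    apply Rdiv_lt_0_compat; [apply Rmult_lt_0_compat; nra | lra]. }
  repeat split; auto.
  - now apply (wave_of_flux_smooth c k B u v).
  - destruct (lim_p_infty_eps _ _ (wave_of_flux c k v 0 - k) (L _ lp)) as [N hN];
      [lra|].
    exists 0, (N + 1). specialize (hN (N + 1) ltac:(lra)).
    apply Rabs_def2 in hN. lra.
  - exists (k * (c - k ^ 2)). now apply (wave_of_flux_profile_eq c k B u v).
Qed.

Lemma wave_unique (c k : R) (phi psi : R -> R) :
  0 < k -> solitary_wave c k phi -> solitary_wave c k psi ->
  Derive phi 0 = 0 -> Derive psi 0 = 0 -> forall x, phi x = psi x.
Proof.
  intros hk W1 W2 d1 d2 x.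
  destruct (wave_range c k phi hk W1) as [r1 r2].
  destruct (crest_parameter_spec c k hk r1 r2) as [hB _].
  assert (e := flux_orbit_unique _ _ _ _ _ hB (wave_flux_orbit c k phi hk W1)
                 (wave_flux_orbit c k psi hk W2)).
  destruct (rel_flux_relations c k phi x hk W1) as [_ [-> _]].
  destruct (rel_flux_relations c k psi x hk W2) as [_ [-> _]].
  rewrite e; auto.
  unfold wave_root. rewrite d1, d2. unfold Rdiv. ring.
Qed.

Lemma derive_reflect (phi : R -> R) (x : R) :
  smooth phi -> Derive (fun y => phi (- y)) x = - Derive phi (- x).
Proof.
  intros H. apply is_derive_unique. evar_last.
  - apply (is_derive_comp phi Ropp x); [now apply smooth_derive|].
    instantiate (1 := - 1). now auto_derive.
  - change (- 1 * Derive phi (- x) = - Derive phi (- x)). ring.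
Qed.

(** Travelling waves are reversible: the profile equation is invariant under
    reflection. *)
Lemma wave_reflect (c k : R) (phi : R -> R) :
  solitary_wave c k phi -> solitary_wave c k (fun x => phi (- x)).
Proof.
  intros [H [[x [y hxy]] [[a P] [hp hm]]]].
  assert (loc : forall n x, locally (- x)
    (fun y => forall j, (j <= n)%nat -> ex_derive_n phi j y))
    by (intros; apply filter_forall; intros; apply H).
  repeat split.
  - intros n z. apply ex_derive_n_comp_opp, loc.
  - exists (- x), (- y). now rewrite !Ropp_involutive.
  - exists a. intros z. unfold mu.
    rewrite (Derive_n_comp_opp phi 2 z (loc 2%nat z)).
    rewrite (derive_reflect phi z H).
    rewrite <- (P (- z)). unfold mu. ring.
  - apply (is_lim_comp phi Ropp p_infty k m_infty hm).
    + apply (is_lim_opp (fun x => x) p_infty p_infty), is_lim_id.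
    + now exists 0.
  - apply (is_lim_comp phi Ropp m_infty k p_infty hp).
    + apply (is_lim_opp (fun x => x) m_infty m_infty), is_lim_id.
    + now exists 0.
Qed.

Theorem lemma3p1 (c k : R) (hc : 0 < c) (hk : 0 < k) :
  ((exists phi : R -> R, solitary_wave c k phi) <->
     sqrt c / 3 < k < sqrt (3 * c) / 3) /\
  (sqrt c / 3 < k < sqrt (3 * c) / 3 ->
     (forall phi : R -> R, solitary_wave c k phi ->
        is_lub (image phi) (sqrt (2 * (c - k ^ 2)) - k) /\
        sqrt (2 * (c - k ^ 2)) - k < sqrt c /\
        (forall xi : R,
           k < phi xi <= sqrt (2 * (c - k ^ 2)) - k /\ 0 < mu phi xi)) /\
     (exists! phi : R -> R, solitary_wave c k phi /\ Derive phi 0 = 0) /\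
     (forall phi : R -> R, solitary_wave c k phi -> Derive phi 0 = 0 ->
        forall xi : R, phi (- xi) = phi xi)).
Proof.
  assert (range := background_range_iff c k hc hk).
  split; [split|].
  - intros [phi W]. apply range. now apply (wave_range c k phi).
  - intros r. apply range in r. destruct (wave_exists c k hk) as [phi [W _]];
      try apply r. now exists phi.
  - intros r. assert (r' := r). apply range in r'. destruct r' as [r1 r2].
    split; [|split].
    + intros phi W. destruct (wave_height c k phi hk W) as [x0 [e0 h0]].
      split; [|split].
      * split.
        -- intros y [x ->]. rewrite <- e0. apply h0.
        -- intros b hb. apply hb. now exists x0.
      * assert (s := pow2_sqrt c ltac:(lra)). assert (p := sqrt_pos c).
        assert (sqrt (2 * (c - k ^ 2)) < sqrt c + k); [|lra].
        rewrite <- (sqrt_pow2 (sqrt c + k)) by lra.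
        (* [2 (c - k^2) < (sqrt c + k)^2] is [0 < (3 k - sqrt c) (k + sqrt c)] *)
        apply sqrt_lt_1_alt. split; [nra|].
        assert (0 < (3 * k - sqrt c) * (k + sqrt c))
          by (apply Rmult_lt_0_compat; lra).
        nra.
      * intros x. split; [split|].
        -- now apply (wave_above_background c).
        -- rewrite <- e0. apply h0.
        -- destruct (rel_flux_relations c k phi x hk W) as [vp [_ [-> _]]].
           now apply Rdiv_lt_0_compat.
    + destruct (wave_exists c k hk r1 r2) as [phi [W d]].
      exists phi. split; auto. intros psi [W' d'].
      apply functional_extensionality. now apply (wave_unique c k).
    + intros phi W d x.
      apply (wave_unique c k (fun x => phi (- x)) phi hk); auto.
      * now apply wave_reflect.
      * rewrite (derive_reflect phi 0 (proj1 W)), Ropp_0, d. ring.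
Qed.
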